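(* Let $f:X\to Y$ be a coarse map of coarse spaces. Then there is a well-defined induced function $f_*:\pi_0^{\mathrm{Crs}}(X)\to\pi_0^{\mathrm{Crs}}(Y)$ given by $[\alpha]_0^{\mathrm{Crs}}\mapsto[f\circ\alpha]_0^{\mathrm{Crs}}$. Further, the assignments $X\mapsto\pi_0^{\mathrm{Crs}}(X)$ on objects and $f\mapsto f_*$ on morphisms define a functor $\pi_0^{\mathrm{Crs}}(-):\mathbf{Crs}\to\mathbf{Set}$.
   Context: A coarse structure on a set $X$ is a collection $\mathcal{C}_X$ of subsets of $X\times X$, called controlled sets, containing the diagonal $\Delta_X$ and closed under subsets, finite unions, inverses $U^{-1}=\{(x,x'):(x',x)\in U\}$ and composites $U\circ V=\{(x,x'):\exists x'',\ (x,x'')\in U,\ (x'',x')\in V\}$. A coarse space is a set with a coarse structure. $B\subseteq X$ is bounded if $B\times B\in\mathcal{C}_X$. A map $f:X\to Y$ of coarse spaces is controlled if $(f\times f)(E)\in\mathcal{C}_Y$ for all $E\in\mathcal{C}_X$, proper if preimages of bounded sets are bounded, and coarse if both. $\mathbf{Crs}$ is the category of coarse spaces and coarse maps. A metric space carries the metric coarse structure, in which $U\subseteq X\times X$ is controlled iff $\sup_{(x,x')\in U}d(x,x')<\infty$. The product coarse structure on $X\times Y$: $E$ is controlled iff its images in $X\times X$ and $Y\times Y$ are controlled. Subspaces carry the restricted coarse structure. For a coarse map $q:X\to\mathbb{R}_{\ge0}$, the $q$-cylinder is $I_qX=\{(x,t)\in X\times\mathbb{R}_{\ge0}: t\le q(x)\}$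 with the coarse subspace structure of the product. Coarse maps $f,g:X\to Y$ are coarse homotopic if there are coarse maps $q:X\to\mathbb{R}_{\ge0}$ and $H:I_qX\to Y$ with $H(x,0)=f(x)$ and $H(x,q(x))=g(x)$ for all $x$. Coarse homotopy is (known to be) an equivalence relation. A coarse ray in $X$ is a coarse map $\mathbb{R}_{\ge0}\to X$. $\pi_0^{\mathrm{Crs}}(X)$ is the set of coarse homotopy classes $[\alpha]_0^{\mathrm{Crs}}$ of coarse rays $\alpha$ in $X$. *)

(* Defs.v *)
From HB Require Import structures.
From mathcomp Require Import all_boot all_order all_algebra.
From mathcomp Require Import all_classical all_reals topology.

Set Implicit Arguments.
Unset Strict Implicit.
Unset Printing Implicit Defensive.

Import Order.TTheory GRing.Theory Num.Theory.
Import numFieldTopology.Exports.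

Local Open Scope classical_set_scope.
Local Open Scope ring_scope.

HB.mixin Record isCoarse (X : Type) := {
  controlled : set_system (X * X) ;
  controlled_diagonal : controlled diagonal ;
  controlled_sub : forall U V, V `<=` U -> controlled U -> controlled V ;
  controlledU : forall U V, controlled U -> controlled V -> controlled (U `|` V) ;
  controlledV : forall U, controlled U -> controlled (U^-1)%relation ;
  (* relational composition: (V \; U) (x, x') iff U (x, x'') and V (x'', x')
     for some x'' *)
  controlled_comp : forall U V,
    controlled U -> controlled V -> controlled (V \; U)%relation
}.

#[short(type="coarseType")]
HB.structure Definition Coarse := { X of isCoarse X }.

Definition coarse_bounded (X : coarseType) (B : set X) : Prop :=
  controlled (B `*` B).

Definition map_sq (S T : Type) (f : S -> T) (p : S * S) : T * T :=
  (f p.1, f p.2).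

Definition controlled_fun (X Y : coarseType) (f : X -> Y) : Prop :=
  forall E : set (X * X), controlled E -> controlled (map_sq f @` E).

Definition proper_fun (X Y : coarseType) (f : X -> Y) : Prop :=
  forall B : set Y, coarse_bounded B -> coarse_bounded (f @^-1` B).

Record coarse_map (X Y : coarseType) := CoarseMap {
  coarse_fun :> X -> Y ;
  coarse_map_controlled : controlled_fun coarse_fun ;
  coarse_map_proper : proper_fun coarse_fun
}.

Lemma coarse_map_eq (X Y : coarseType) (f g : coarse_map X Y) :
  f =1 g -> f = g.
Proof.
case: f g => [f cf pf] [g cg pg] /= /funext fg; case: _ / fg cg pg => cg pg.
by congr CoarseMap; exact: Prop_irrelevance.
Qed.

Section identity_and_composition.
Variables X Y Z : coarseType.

Lemma controlled_fun_id : controlled_fun (@idfun X).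
Proof. by move=> E; apply: controlled_sub => _ [[x y] Exy <-]. Qed.

Lemma proper_fun_id : proper_fun (@idfun X).
Proof. by []. Qed.

Definition coarse_id : coarse_map X X :=
  CoarseMap controlled_fun_id proper_fun_id.

Variables (g : coarse_map Y Z) (f : coarse_map X Y).

Lemma controlled_fun_comp : controlled_fun (g \o f).
Proof.
move=> E /(coarse_map_controlled f)/(coarse_map_controlled g).
apply: controlled_sub => _ [[x y] Exy <-].
by exists (f x, f y) => //; exists (x, y).
Qed.

Lemma proper_fun_comp : proper_fun (g \o f).
Proof. by move=> B /(coarse_map_proper g)/(coarse_map_proper f). Qed.

Definition coarse_comp : coarse_map X Z :=
  CoarseMap controlled_fun_comp proper_fun_comp.

End identity_and_composition.

Section initial_coarse.
Variables (T : Type) (X : coarseType) (f : T -> X).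
Implicit Types U V : set (T * T).

Definition initial_controlled : set_system (T * T) :=
  [set U | controlled (map_sq f @` U)].

Lemma initial_controlled_diagonal : initial_controlled diagonal.
Proof.
apply: controlled_sub controlled_diagonal => _ [[x y] /= + <-].
by rewrite /diagonal /= => ->.
Qed.

Lemma initial_controlled_sub U V :
  V `<=` U -> initial_controlled U -> initial_controlled V.
Proof. by move=> VU; apply: controlled_sub; exact: image_subset. Qed.

Lemma initial_controlledU U V :
  initial_controlled U -> initial_controlled V -> initial_controlled (U `|` V).
Proof.
by move=> cU cV; rewrite /initial_controlled /= image_setU; exact: controlledU.
Qed.

Lemma initial_controlledV U :
  initial_controlled U -> initial_controlled (U^-1)%relation.
Proof.
move=> /controlledV; apply: controlled_sub => _ [[x y] /= Uyx <-].
by exists (y, x).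
Qed.

Lemma initial_controlled_comp U V :
  initial_controlled U -> initial_controlled V ->
  initial_controlled (V \; U)%relation.
Proof.
move=> cU cV; have := controlled_comp _ _ cU cV.
apply: controlled_sub => _ [[x y] /= [z Uxz Vzy] <-].
by exists (f z); [exists (x, z)|exists (z, y)].
Qed.

End initial_coarse.

HB.instance Definition _ (X : coarseType) (A : set X) :=
  isCoarse.Build (set_type A)
    (@initial_controlled_diagonal A X val)
    (@initial_controlled_sub A X val)
    (@initial_controlledU A X val)
    (@initial_controlledV A X val)
    (@initial_controlled_comp A X val).

Section product_coarse.
Variables X Y : coarseType.

Let ctrl : set_system ((X * Y) * (X * Y)) :=
  [set E | controlled (map_sq fst @` E) /\ controlled (map_sq snd @` E)].

Let ctrl_diagonal : ctrl diagonal.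
Proof. by split; exact: initial_controlled_diagonal. Qed.

Let ctrl_sub U V : V `<=` U -> ctrl U -> ctrl V.
Proof. by move=> VU [? ?]; split; exact: initial_controlled_sub VU _. Qed.

Let ctrlU U V : ctrl U -> ctrl V -> ctrl (U `|` V).
Proof. by move=> [? ?] [? ?]; split; exact: initial_controlledU. Qed.

Let ctrlV U : ctrl U -> ctrl (U^-1)%relation.
Proof. by move=> [? ?]; split; exact: initial_controlledV. Qed.

Let ctrl_comp U V : ctrl U -> ctrl V -> ctrl (V \; U)%relation.
Proof. by move=> [? ?] [? ?]; split; exact: initial_controlled_comp. Qed.

HB.instance Definition _ :=
  isCoarse.Build (X * Y)%type ctrl_diagonal ctrl_sub ctrlU ctrlV ctrl_comp.

End product_coarse.

(* An alias: a metric type may carry several coarse structures. *)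
Definition metric_coarse (R : realType) (M : metricType R) : Type := M.

Section metric_coarse.
Variables (R : realType) (M : metricType R).

Let ctrl : set_system (metric_coarse M * metric_coarse M) :=
  [set U | has_ubound [set mdist (p.1 : M) (p.2 : M) | p in U]].

Let ctrl_diagonal : ctrl diagonal.
Proof.
by exists 0 => _ [[x y] /= + <-]; rewrite /diagonal /= => ->; rewrite mdistxx.
Qed.

Let ctrl_sub U V : V `<=` U -> ctrl U -> ctrl V.
Proof. by move=> VU; apply: subset_has_ubound; exact: image_subset. Qed.

Let ctrlU U V : ctrl U -> ctrl V -> ctrl (U `|` V).
Proof.
move=> [a Ua] [b Vb]; exists (Num.max a b) => _ [p [Up|Vp] <-].
- by rewrite le_max (Ua _ (imageP _ Up)).
- by rewrite le_max (Vb _ (imageP _ Vp)) orbT.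
Qed.

Let ctrlV U : ctrl U -> ctrl (U^-1)%relation.
Proof.
move=> [a Ua]; exists a => _ [[x y] /= Uyx <-].
by rewrite metric_sym; apply: Ua; exists (y, x).
Qed.

Let ctrl_comp U V : ctrl U -> ctrl V -> ctrl (V \; U)%relation.
Proof.
move=> [a Ua] [b Vb]; exists (a + b) => _ [[x y] /= [z Uxz Vzy] <-].
apply: le_trans (metric_triangle (x : M) z y) _.
by apply: lerD; [apply: Ua; exists (x, z)|apply: Vb; exists (z, y)].
Qed.

HB.instance Definition _ :=
  isCoarse.Build (metric_coarse M) ctrl_diagonal ctrl_sub ctrlU ctrlV ctrl_comp.

End metric_coarse.

Definition halfline (R : realType) : coarseType :=
  Coarse.clone (set_type [set t : metric_coarse R^o | (0 : R) <= t]) _.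

Definition halfline_val (R : realType) (t : halfline R) : R := val t.

Lemma halfline_val_ge0 (R : realType) (t : halfline R) : 0 <= halfline_val t.
Proof. exact: set_valP t. Qed.

Definition halfline0 (R : realType) : halfline R :=
  exist _ (0 : R) (mem_set (lexx (0 : R))).

Section coarse_homotopy.
Variable R : realType.

Section cylinder.
Variables (X : coarseType) (q : coarse_map X (halfline R)).

Definition cylinder : coarseType :=
  Coarse.clone (set_type
    [set z : X * halfline R | halfline_val z.2 <= halfline_val (q z.1)]) _.

Definition cylinder_bottom (x : X) : cylinder :=
  exist _ (x, halfline0 R) (mem_set (halfline_val_ge0 (q x))).

Definition cylinder_top (x : X) : cylinder :=
  exist _ (x, q x) (mem_set (lexx (halfline_val (q x)))).

End cylinder.

Definition coarse_homotopic (X Y : coarseType) (f g : coarse_map X Y) : Prop :=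
  exists (q : coarse_map X (halfline R)) (H : coarse_map (cylinder q) Y),
    (forall x, H (cylinder_bottom q x) = f x) /\
    (forall x, H (cylinder_top q x) = g x).

Definition coarse_ray (X : coarseType) := coarse_map (halfline R) X.

Definition homotopy_class (X : coarseType) (a : coarse_ray X) :
    set (coarse_ray X) :=
  [set b | coarse_homotopic a b].

(* The quotient set, as the set of all equivalence classes. *)
Definition pi0 (X : coarseType) : Type := range (@homotopy_class X).

Definition pi0_class (X : coarseType) (a : coarse_ray X) : pi0 X :=
  exist _ (homotopy_class a) (mem_set (imageT (@homotopy_class X) a)).

End coarse_homotopy.

Record category := Category {
  ob :> Type ;
  mor : ob -> ob -> Type ;
  id_mor : forall a, mor a a ;
  comp_mor : forall a b c, mor b c -> mor a b -> mor a c ;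
  comp_id_mor : forall a b (f : mor a b), comp_mor (id_mor b) f = f ;
  comp_mor_id : forall a b (f : mor a b), comp_mor f (id_mor a) = f ;
  comp_morA : forall a b c d (h : mor c d) (g : mor b c) (f : mor a b),
    comp_mor h (comp_mor g f) = comp_mor (comp_mor h g) f
}.

Record is_functor (C D : category) (F0 : C -> D)
    (F1 : forall a b : C, mor a b -> mor (F0 a) (F0 b)) : Prop := IsFunctor {
  functor_id : forall a : C, F1 a a (id_mor a) = id_mor (F0 a) ;
  functor_comp : forall (a b c : C) (g : mor b c) (f : mor a b),
    F1 a c (comp_mor g f) = comp_mor (F1 b c g) (F1 a b f)
}.

Definition Crs : category.
Proof.
apply: (@Category coarseType coarse_map coarse_id coarse_comp) => *;
  exact: coarse_map_eq.
Defined.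

Definition Sets : category :=
  @Category Type (fun A B => A -> B) (fun A => @idfun A)
    (fun A B C g f => g \o f)
    (fun _ _ _ => erefl) (fun _ _ _ => erefl) (fun _ _ _ _ _ _ _ => erefl).

(* Main.v *)
(* The point is that coarse homotopy is an equivalence relation on rays.
   Reflexivity uses the identity cylinder height, which is where the source
   being the half line matters; symmetry flips the cylinder by t |-> q x - t.
   For transitivity, homotopies H1 over q1 and H2 over q2 are glued over
   q1 + q2. The clamping maps (x, t) |-> (x, min t (q1 x)) and
   (x, t) |-> (x, max 0 (t - q1 x)) are controlled, and a pair of points on
   opposite sides of the graph of q1 is handled by passing through the common
   map g = H1 (_, q1 _) = H2 (_, 0). *)
Require Import Defs.
From mathcomp Require Import all_boot all_order all_algebra.
From mathcomp Require Import all_classical all_reals topology.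
From mathcomp Require Import lra.

Set Implicit Arguments.
Unset Strict Implicit.
Unset Printing Implicit Defensive.

Import Order.TTheory GRing.Theory Num.Theory.

Local Open Scope classical_set_scope.
Local Open Scope ring_scope.

(** * Bounded sets and coarse components *)

Section coarse_basics.
Variable X : coarseType.
Implicit Types (A B : set X) (x y z : X).

Lemma coarse_bounded_sub A B :
  A `<=` B -> coarse_bounded B -> coarse_bounded A.
Proof. by move=> AB; apply: controlled_sub => -[x y] /= [/AB ? /AB ?]. Qed.

(** That [[set (x, y)]] is controlled means that [x] and [y] lie in the same coarse component, a
    relation that need not be total. *)
Lemma controlled_pair_refl x : controlled [set (x, x)].
Proof. by apply: controlled_sub controlled_diagonal => _ ->. Qed.

Lemma controlled_pair_trans y x z :
  controlled [set (x, y)] -> controlled [set (y, z)] -> controlled [set (x, z)].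
Proof.
move=> xy yz; have := controlled_comp _ _ xy yz.
by apply: controlled_sub => _ ->; exists y.
Qed.

Lemma controlled_pair_bounded B x y :
  coarse_bounded B -> B x -> B y -> controlled [set (x, y)].
Proof. by move=> bB Bx By; apply: controlled_sub bB => _ ->. Qed.

Lemma coarse_bounded1 x : coarse_bounded [set x].
Proof.
by apply: controlled_sub (controlled_pair_refl x) => -[a b] /= [-> ->].
Qed.

(** One controlled pair [(x, y)] is enough, since [A * B] lies in the composite of [A * A], that
    pair and [B * B]. Quantifying over all pairs makes the hypothesis vacuous when a set is
    empty. *)
Lemma coarse_boundedU A B : coarse_bounded A -> coarse_bounded B ->
  (forall x y, A x -> B y -> controlled [set (x, y)]) ->
  coarse_bounded (A `|` B).
Proof.
move=> bA bB AB.
have [->|/set0P[x Ax]] := eqVneq A set0; first by rewrite set0U.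
have [->|/set0P[y By]] := eqVneq B set0; first by rewrite setU0.
have cAB := controlled_comp _ _ (controlled_comp _ _ bA (AB x y Ax By)) bB.
have := controlledU _ _ (controlledU _ _ bA bB)
                        (controlledU _ _ cAB (controlledV _ cAB)).
apply: controlled_sub => -[a b] [/= [Aa|Ba] [Ab|Bb]].
- by left; left.
- by right; left; exists y => //; exists x.
- by right; right; exists y => //; exists x.
- by left; right.
Qed.

End coarse_basics.

Lemma controlled_pair_image (X Y : coarseType) (f : X -> Y) (x y : X) :
  controlled_fun f -> controlled [set (x, y)] -> controlled [set (f x, f y)].
Proof.
by move=> cf /cf; apply: controlled_sub => _ ->; exists (x, y).
Qed.

Lemma coarse_bounded_image (X Y : coarseType) (f : X -> Y) (B : set X) :
  controlled_fun f -> coarse_bounded B -> coarse_bounded (f @` B).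
Proof.
move=> cf /cf; apply: controlled_sub => -[_ _] [/= [x Bx <-] [y By <-]].
by exists (x, y).
Qed.

(** Properness makes coarse maps reflect components: the two values form a bounded set, whose
    bounded preimage contains [x] and [y]. *)
Lemma controlled_pair_preimage (X Y : coarseType) (f : coarse_map X Y) (x y : X) :
  controlled [set (f x, f y)] -> controlled [set (x, y)].
Proof.
move=> fxy.
have bfxy : coarse_bounded ([set f x] `|` [set f y]).
  by apply: coarse_boundedU; [exact: coarse_bounded1..|move=> _ _ -> ->].
apply: controlled_pair_bounded (coarse_map_proper f bfxy) _ _.
- by left.
- by right.
Qed.

(** * The half line and controlled real functions *)

Section halfline.
Variable R : realType.
Implicit Types t : halfline R.

Definition halfline_of (r : R) (r0 : 0 <= r) : halfline R :=
  exist _ r (mem_set r0).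

Lemma halfline_val_inj : injective (@halfline_val R).
Proof. exact: val_inj. Qed.

Lemma halfline_controlledP (E : set (halfline R * halfline R)) :
  controlled E <->
  exists C, forall p, E p -> `|halfline_val p.1 - halfline_val p.2| <= C.
Proof.
split=> -[C EC]; exists C.
- move=> p Ep; rewrite distrC.
  by apply: EC; exists (map_sq val p) => //; exists p.
- by move=> _ [_ [p Ep <-] <-]; rewrite [leLHS]distrC; exact: EC.
Qed.

Lemma halfline_boundedP (B : set (halfline R)) :
  coarse_bounded B <-> exists C, forall t, B t -> halfline_val t <= C.
Proof.
split.
- move=> /halfline_controlledP[C BC].
  have [->|/set0P[t Bt]] := eqVneq B set0; first by exists 0.
  exists (halfline_val t + C) => s Bs.
  by have := BC (s, t) (conj Bs Bt); rewrite ler_norml /=; lra.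
- move=> [C BC]; apply/halfline_controlledP; exists C => -[s t] [/= /BC sC /BC tC].
  have := halfline_val_ge0 s; have := halfline_val_ge0 t.
  by rewrite ler_norml; lra.
Qed.

(** Values range over all of [R] because differences such as height minus [q1] may leave the half
    line before being clamped. *)
Definition controlled_real (X : coarseType) (u : X -> R) :=
  forall E : set (X * X), controlled E ->
    exists C, forall p, E p -> `|u p.1 - u p.2| <= C.

Lemma controlled_halfline_funP (X : coarseType) (f : X -> halfline R) :
  controlled_fun f <-> controlled_real (fun x => halfline_val (f x)).
Proof.
split=> cf E /cf.
- move=> /halfline_controlledP[C EC]; exists C => p Ep.
  by apply: (EC (map_sq f p)); exists p.
- move=> [C EC]; apply/halfline_controlledP; exists C => _ [p Ep <-].
  exact: EC.
Qed.

Section controlled_real.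
Variables (X : coarseType) (u v : X -> R).
Hypotheses (cu : controlled_real u) (cv : controlled_real v).

Lemma controlled_realB : controlled_real (fun x => u x - v x).
Proof.
move=> E cE; have [[C EC] [D ED]] := (cu cE, cv cE); exists (C + D) => p Ep.
by move: (EC p Ep) (ED p Ep); rewrite !ler_norml; lra.
Qed.

Lemma controlled_realD : controlled_real (fun x => u x + v x).
Proof.
move=> E cE; have [[C EC] [D ED]] := (cu cE, cv cE); exists (C + D) => p Ep.
by move: (EC p Ep) (ED p Ep); rewrite !ler_norml; lra.
Qed.

Lemma controlled_real_min : controlled_real (fun x => Num.min (u x) (v x)).
Proof.
move=> E cE; have [[C EC] [D ED]] := (cu cE, cv cE); exists (C + D) => p Ep.
(* A minimum varies by at most the larger of [C] and [D]; both are nonnegative here, so [C + D]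
   suffices. *)
move: (EC p Ep) (ED p Ep); rewrite !ler_norml.
by case: (leP (u p.1)); case: (leP (u p.2)); lra.
Qed.

End controlled_real.

Lemma controlled_real_max0 (X : coarseType) (u : X -> R) :
  controlled_real u -> controlled_real (fun x => Num.max 0 (u x)).
Proof.
move=> cu E /cu[C EC]; exists C => p /EC; rewrite !ler_norml.
by case: (leP 0 (u p.1)); case: (leP 0 (u p.2)); lra.
Qed.

(** * The cylinder, its projection and its flip *)

Section cylinder.
Variables (X : coarseType) (q : coarse_map X (halfline R)).
Implicit Types z w : cylinder q.

Definition cylinder_base z : X := (val z).1.
Definition cylinder_height z : R := halfline_val (val z).2.

Lemma cylinder_height_ge0 z : 0 <= cylinder_height z.
Proof. exact: halfline_val_ge0. Qed.

Lemma cylinder_height_le z : cylinder_height z <= halfline_val (q (cylinder_base z)).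
Proof. exact: set_valP z. Qed.

Definition cylinder_pt (x : X) (r : R) (r0 : 0 <= r)
    (rq : r <= halfline_val (q x)) : cylinder q :=
  exist _ (x, halfline_of r0) (mem_set rq).

Lemma cylinder_eq z w : cylinder_base z = cylinder_base w ->
  cylinder_height z = cylinder_height w -> z = w.
Proof.
move=> bE /halfline_val_inj hE; apply: val_inj; move: bE hE.
by rewrite /cylinder_base; case: (val z) (val w) => [x s] [y t] /= -> ->.
Qed.

Lemma cylinder_controlledP (E : set (cylinder q * cylinder q)) :
  controlled E <-> controlled (map_sq cylinder_base @` E) /\
  exists C, forall p, E p -> `|cylinder_height p.1 - cylinder_height p.2| <= C.
Proof.
split.
- move=> [c1 /halfline_controlledP[C EC]]; split.
    by apply: controlled_sub c1 => _ [p Ep <-]; exists (map_sq val p) => //; exists p.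
  exists C => p Ep; apply: (EC (map_sq snd (map_sq val p))).
  by exists (map_sq val p) => //; exists p.
- move=> [c1 [C EC]]; split.
    by apply: controlled_sub c1 => _ [_ [p Ep <-] <-]; exists p.
  apply/halfline_controlledP; exists C => _ [_ [p Ep <-] <-]; exact: (EC p).
Qed.

Lemma controlled_cylinder_base : controlled_fun cylinder_base.
Proof. by move=> E /cylinder_controlledP[]. Qed.

Lemma controlled_cylinder_height : controlled_real cylinder_height.
Proof. by move=> E /cylinder_controlledP[]. Qed.

Lemma controlled_height_of_base :
  controlled_real (fun x => halfline_val (q x)).
Proof. exact/controlled_halfline_funP/coarse_map_controlled. Qed.

Lemma controlled_real_base (u : X -> R) :
  controlled_real u -> controlled_real (fun z => u (cylinder_base z)).
Proof.
move=> cu E /controlled_cylinder_base/cu[C EC]; exists C => p Ep.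
by apply: (EC (map_sq cylinder_base p)); exists p.
Qed.

Lemma controlled_fun_cylinder (Y : coarseType) (h : Y -> cylinder q) :
  controlled_fun (cylinder_base \o h) ->
  controlled_real (cylinder_height \o h) -> controlled_fun h.
Proof.
move=> cb ch E cE; apply/cylinder_controlledP; split.
  by apply: controlled_sub (cb _ cE) => _ [_ [p Ep <-] <-]; exists p.
by have [C EC] := ch _ cE; exists C => _ [p Ep <-]; exact: EC.
Qed.

(** Heights lie between 0 and [q], and the controlled map [q] is bounded on a bounded base.
    Properness questions on cylinders thus reduce to the base. *)
Lemma cylinder_boundedP (B : set (cylinder q)) :
  coarse_bounded B <-> coarse_bounded (cylinder_base @` B).
Proof.
split; first by apply: coarse_bounded_image; exact: controlled_cylinder_base.
move=> bB; apply/cylinder_controlledP; split.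
  by apply: controlled_sub bB => _ [[z w] [Bz Bw] <-]; split; [exists z|exists w].
have /halfline_boundedP[C BC] :=
  coarse_bounded_image (coarse_map_controlled q) bB.
exists C => -[z w] [/= Bz Bw].
have zC : halfline_val (q (cylinder_base z)) <= C by apply: BC; do 2 apply: imageP.
have wC : halfline_val (q (cylinder_base w)) <= C by apply: BC; do 2 apply: imageP.
have := cylinder_height_ge0 z; have := cylinder_height_ge0 w.
have := cylinder_height_le z; have := cylinder_height_le w.
by rewrite ler_norml; lra.
Qed.

Lemma proper_cylinder_base : proper_fun cylinder_base.
Proof.
move=> B bB; apply/cylinder_boundedP; apply: coarse_bounded_sub bB.
by move=> _ [z Bz <-].
Qed.

Definition cylinder_proj : coarse_map (cylinder q) X :=
  CoarseMap controlled_cylinder_base proper_cylinder_base.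

(** The projection is coarse, hence reflects components. This permits vertical moves in the proof
    that the glued map is proper. *)
Lemma controlled_pair_fiber z w :
  cylinder_base z = cylinder_base w -> controlled [set (z, w)].
Proof.
move=> zw; apply: (@controlled_pair_preimage _ _ cylinder_proj) => /=.
rewrite zw; exact: controlled_pair_refl.
Qed.

Definition cylinder_flip z : cylinder q.
Proof.
apply: (@cylinder_pt (cylinder_base z)
         (halfline_val (q (cylinder_base z)) - cylinder_height z)).
- by rewrite subr_ge0; exact: cylinder_height_le.
- by rewrite gerBl; exact: cylinder_height_ge0.
Defined.

Lemma controlled_cylinder_flip : controlled_fun cylinder_flip.
Proof.
apply: controlled_fun_cylinder; first exact: controlled_cylinder_base.
apply: controlled_realB controlled_cylinder_height.
exact: controlled_real_base controlled_height_of_base.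
Qed.

Lemma proper_cylinder_flip : proper_fun cylinder_flip.
Proof.
move=> B /cylinder_boundedP bB; apply/cylinder_boundedP.
by apply: coarse_bounded_sub bB => _ [z Bz <-]; exists (cylinder_flip z).
Qed.

Definition cylinder_flip_map : coarse_map (cylinder q) (cylinder q) :=
  CoarseMap controlled_cylinder_flip proper_cylinder_flip.

Lemma cylinder_flip_bottom x : cylinder_flip (cylinder_bottom q x) = cylinder_top q x.
Proof. by apply: cylinder_eq => //; exact: subr0. Qed.

Lemma cylinder_flip_top x : cylinder_flip (cylinder_top q x) = cylinder_bottom q x.
Proof. by apply: cylinder_eq => //; exact: subrr. Qed.

End cylinder.

(** * Gluing two homotopies over the sum of their heights *)

Section halfline_add.
Variables (X : coarseType) (q1 q2 : coarse_map X (halfline R)).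

Definition halfline_add (x : X) : halfline R :=
  halfline_of (addr_ge0 (halfline_val_ge0 (q1 x)) (halfline_val_ge0 (q2 x))).

Lemma controlled_halfline_add : controlled_fun halfline_add.
Proof.
apply/controlled_halfline_funP.
exact: controlled_realD (@controlled_height_of_base _ q1)
                        (@controlled_height_of_base _ q2).
Qed.

(** Since [q1] is at most the sum, a bound on the sum bounds [q1], and properness of [q1]
    concludes. *)
Lemma proper_halfline_add : proper_fun halfline_add.
Proof.
move=> B /halfline_boundedP[C BC].
have /(coarse_map_proper q1) :
  coarse_bounded [set t : halfline R | halfline_val t <= C].
  by apply/halfline_boundedP; exists C.
apply: coarse_bounded_sub => x /BC /=; apply: le_trans.
by rewrite lerDl; exact: halfline_val_ge0.
Qed.

Definition halfline_add_map : coarse_map X (halfline R) :=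
  CoarseMap controlled_halfline_add proper_halfline_add.

Local Notation q := halfline_add_map.
Implicit Types z : cylinder q.

Definition clamp_low z : cylinder q1.
Proof.
apply: (@cylinder_pt _ q1 (cylinder_base z)
  (Num.min (cylinder_height z) (halfline_val (q1 (cylinder_base z))))).
- by rewrite le_min cylinder_height_ge0 halfline_val_ge0.
- by rewrite ge_min lexx orbT.
Defined.

Definition clamp_high z : cylinder q2.
Proof.
apply: (@cylinder_pt _ q2 (cylinder_base z)
  (Num.max 0 (cylinder_height z - halfline_val (q1 (cylinder_base z))))).
- by rewrite le_max lexx.
- rewrite ge_max halfline_val_ge0 /= lerBlDl; exact: cylinder_height_le.
Defined.

Lemma controlled_clamp_low : controlled_fun clamp_low.
Proof.
apply: controlled_fun_cylinder; first exact: controlled_cylinder_base.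
apply: controlled_real_min; first exact: controlled_cylinder_height.
exact: controlled_real_base (@controlled_height_of_base _ q1).
Qed.

Lemma controlled_clamp_high : controlled_fun clamp_high.
Proof.
apply: controlled_fun_cylinder; first exact: controlled_cylinder_base.
apply: controlled_real_max0; apply: controlled_realB.
  exact: controlled_cylinder_height.
exact: controlled_real_base (@controlled_height_of_base _ q1).
Qed.

(** Beyond the graph of [q1] this clamp is stuck at the top, where [H1] agrees with [g];
    [clamp_high_bottom] is the counterpart for [H2]. *)
Lemma clamp_low_top z :
  halfline_val (q1 (cylinder_base z)) <= cylinder_height z ->
  clamp_low z = cylinder_top q1 (cylinder_base z).
Proof. by move=> zq; apply: cylinder_eq => //; exact/min_idPr. Qed.

Lemma clamp_high_bottom z :
  cylinder_height z <= halfline_val (q1 (cylinder_base z)) ->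
  clamp_high z = cylinder_bottom q2 (cylinder_base z).
Proof.
by move=> zq; apply: cylinder_eq => //; apply/max_idPl; rewrite subr_le0.
Qed.

Section glue.
Variables (Y : coarseType) (g : coarse_map X Y).
Variables (H1 : coarse_map (cylinder q1) Y) (H2 : coarse_map (cylinder q2) Y).
Hypothesis H1g : forall x, H1 (cylinder_top q1 x) = g x.
Hypothesis H2g : forall x, H2 (cylinder_bottom q2 x) = g x.

(** On the graph of [q1] both branches equal [g] at the base point, by [H1g] and [H2g]. *)
Definition glue z : Y :=
  if cylinder_height z <= halfline_val (q1 (cylinder_base z))
  then H1 (clamp_low z) else H2 (clamp_high z).

Lemma controlled_glue : controlled_fun glue.
Proof.
move=> E cE.
have c1 := coarse_map_controlled H1 (controlled_clamp_low cE).
have c2 := coarse_map_controlled H2 (controlled_clamp_high cE).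
(* For [z] below the graph and [w] above, the chain runs from [H1 (clamp_low z)] to
   [H1 (clamp_low w)], which is [g] over [w], then to [g] over [z], which is [H2 (clamp_high z)],
   and on to [H2 (clamp_high w)]. Its middle link goes from [w] back to [z], hence the inverse. The
   other composite serves the mirrored case. *)
have cg := controlledV _
  (coarse_map_controlled g (@controlled_cylinder_base _ _ _ cE)).
set F1 := _ @` _ in c1; set F2 := _ @` _ in c2; set G := (_^-1)%relation in cg.
have := controlledU _ _ (controlledU _ _ c1 c2)
  (controlledU _ _ (controlled_comp _ _ (controlled_comp _ _ c1 cg) c2)
                   (controlled_comp _ _ (controlled_comp _ _ c2 cg) c1)).
apply: controlled_sub => _ [[z w] Ezw <-]; rewrite /map_sq /glue /=.
have F1zw : F1 (H1 (clamp_low z), H1 (clamp_low w)).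
  by exists (clamp_low z, clamp_low w) => //; exists (z, w).
have F2zw : F2 (H2 (clamp_high z), H2 (clamp_high w)).
  by exists (clamp_high z, clamp_high w) => //; exists (z, w).
have Gwz : G (g (cylinder_base w), g (cylinder_base z)).
  by exists (cylinder_base z, cylinder_base w) => //; exists (z, w).
case: leP => [zq|/ltW zq]; case: leP => [wq|/ltW wq].
- by left; left.
- right; left; exists (g (cylinder_base z)).
    by exists (g (cylinder_base w)) => //; rewrite -H1g -clamp_low_top.
  by rewrite -H2g -clamp_high_bottom.
- right; right; exists (g (cylinder_base z)).
    by exists (g (cylinder_base w)) => //; rewrite -H2g -clamp_high_bottom.
  by rewrite -H1g -clamp_low_top.
- by left; right.
Qed.

Lemma proper_glue : proper_fun glue.
Proof.
move=> B bB; apply/cylinder_boundedP.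
have /cylinder_boundedP b1 := coarse_map_proper H1 bB.
have /cylinder_boundedP b2 := coarse_map_proper H2 bB.
(* Clamping keeps the base point, so the preimage of [B] projects into the union of the projections
   of its preimages under [H1] and [H2]. *)
apply: coarse_bounded_sub (coarse_boundedU b1 b2 _).
  move=> _ [z + <-]; rewrite /preimage /glue /=.
  by case: ifP => _ Bz; [left; exists (clamp_low z)|right; exists (clamp_high z)].
(* [X] need not be connected: the two pieces lie in the same coarse component
   because their images under [g] do. *)
move=> _ _ [z Bz <-] [w Bw <-]; apply: (@controlled_pair_preimage _ _ g).
rewrite -H1g -H2g.
(* Move along the fibre from the top to [z], jump from [H1 z] to [H2 w] inside the bounded set [B],
   then move along the fibre from [w] to the bottom. *)
apply: (@controlled_pair_trans _ (H1 z)).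
  by apply: controlled_pair_image (coarse_map_controlled H1) _;
    exact: controlled_pair_fiber.
apply: (@controlled_pair_trans _ (H2 w)).
  exact: controlled_pair_bounded bB Bz Bw.
by apply: controlled_pair_image (coarse_map_controlled H2) _;
  exact: controlled_pair_fiber.
Qed.

Definition glue_map : coarse_map (cylinder q) Y :=
  CoarseMap controlled_glue proper_glue.

Lemma glue_bottom x : glue (cylinder_bottom q x) = H1 (cylinder_bottom q1 x).
Proof.
rewrite /glue ifT; last exact: halfline_val_ge0.
congr (H1 _); apply: cylinder_eq => //; apply/min_idPl.
exact: halfline_val_ge0.
Qed.

Lemma glue_top x : glue (cylinder_top q x) = H2 (cylinder_top q2 x).
Proof.
have -> : glue (cylinder_top q x) = H2 (clamp_high (cylinder_top q x)).
  rewrite /glue; case: ifP => // xq.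
  (* The low branch is taken at the top only if [q2 x] is 0, and then both branches give [g x]. *)
  rewrite clamp_high_bottom // H2g clamp_low_top ?H1g //.
  by rewrite /cylinder_height /halfline_val /= lerDl; exact: halfline_val_ge0.
congr (H2 _); apply: cylinder_eq => //.
rewrite /cylinder_height /halfline_val /= addrC addKr.
exact/max_idPr/halfline_val_ge0.
Qed.

End glue.
End halfline_add.

(** * Coarse homotopy as an equivalence relation *)

Section coarse_homotopy_equivalence.
Variables X Y : coarseType.
Implicit Types f g h : coarse_map X Y.

(* A coarse map to the half line is needed even for a constant homotopy; for
   rays, the identity provides one. *)
Lemma coarse_homotopic_refl (q : coarse_map X (halfline R)) f :
  coarse_homotopic R f f.
Proof. by exists q, (coarse_comp f (cylinder_proj q)). Qed.

Lemma coarse_homotopic_sym f g :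
  coarse_homotopic R f g -> coarse_homotopic R g f.
Proof.
move=> [q [H [Hf Hg]]]; exists q, (coarse_comp H (cylinder_flip_map q)).
by split=> x /=; rewrite ?cylinder_flip_bottom ?cylinder_flip_top.
Qed.

Lemma coarse_homotopic_trans g f h :
  coarse_homotopic R f g -> coarse_homotopic R g h -> coarse_homotopic R f h.
Proof.
move=> [q1 [H1 [H1f H1g]]] [q2 [H2 [H2g H2h]]].
exists (halfline_add_map q1 q2), (glue_map H1g H2g).
by split=> x /=; rewrite ?glue_bottom ?(glue_top H1g H2g).
Qed.

End coarse_homotopy_equivalence.

(** The cylinder is kept and the homotopy is followed by [k]; this gives independence of the
    representative in [pi0_map_class]. *)
Lemma coarse_homotopic_postcomp (X Y Z : coarseType) (k : coarse_map Y Z)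
    (f g : coarse_map X Y) :
  coarse_homotopic R f g ->
  coarse_homotopic R (coarse_comp k f) (coarse_comp k g).
Proof.
move=> [q [H [Hf Hg]]]; exists q, (coarse_comp k H).
by split=> x /=; rewrite ?Hf ?Hg.
Qed.

End halfline.

(** * Homotopy classes of rays and functoriality *)

Section pi0.
Variables (R : realType) (X : coarseType).

Lemma pi0_classP (a b : coarse_ray R X) :
  pi0_class a = pi0_class b <-> coarse_homotopic R a b.
Proof.
split=> [/(congr1 val)/= ab|ab].
  (* Reflexivity puts [b] in its own class, with the identity of the half line as cylinder
     height. *)
  have : homotopy_class b b by exact: coarse_homotopic_refl (coarse_id _) b.
  by rewrite -ab.
apply: val_inj; apply/seteqP; split=> c /=; last exact: coarse_homotopic_trans.
by apply: coarse_homotopic_trans; exact: coarse_homotopic_sym.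
Qed.

Lemma pi0_class_surj (c : pi0 R X) : exists a, pi0_class a = c.
Proof. by have [a _ ac] := set_valP c; exists a; exact: val_inj. Qed.

End pi0.

(** A class is a set of rays, so a representative is chosen; [pi0_map_class] shows that the choice
    does not matter. *)
Definition pi0_map (R : realType) (X Y : coarseType) (f : coarse_map X Y)
    (c : pi0 R X) : pi0 R Y :=
  pi0_class (coarse_comp f (projT1 (cid (pi0_class_surj c)))).

Lemma pi0_map_class (R : realType) (X Y : coarseType) (f : coarse_map X Y)
    (a : coarse_ray R X) :
  pi0_map f (pi0_class a) = pi0_class (coarse_comp f a).
Proof.
rewrite /pi0_map; case: cid => b /= /pi0_classP ba.
by apply/pi0_classP; exact: coarse_homotopic_postcomp.
Qed.

Theorem proposition6p15 (R : realType) :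
  (forall (X Y : coarseType) (f : coarse_map X Y),
    exists! fs : pi0 R X -> pi0 R Y,
      forall a : coarse_ray R X, fs (pi0_class a) = pi0_class (coarse_comp f a))
  /\
  (exists pi0_map : forall X Y : Crs, mor X Y -> pi0 R X -> pi0 R Y,
    (forall (X Y : coarseType) (f : coarse_map X Y) (a : coarse_ray R X),
      pi0_map X Y f (pi0_class a) = pi0_class (coarse_comp f a))
    /\ @is_functor Crs Sets (pi0 R) pi0_map).
Proof.
split.
  move=> X Y f; exists (pi0_map f); split; first exact: pi0_map_class.
  move=> fs fsE; apply/funext => c; have [a <-] := pi0_class_surj c.
  by rewrite pi0_map_class fsE.
exists (@pi0_map R); split; first exact: pi0_map_class.
(* On a representative, both functor laws become pointwise equalities of coarse maps. *)
split=> [X|X Y Z g f]; apply/funext => c; have [a <-] := pi0_class_surj c => /=.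
  by rewrite pi0_map_class; congr pi0_class; exact: coarse_map_eq.
by rewrite !pi0_map_class; congr pi0_class; exact: coarse_map_eq.
Qed.
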